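(* The function $\mathcal{B}=\mathcal{S}\circ\mathcal{D}:\mathcal{F}^{(n\ldots 1)}\to\mathcal{T}_n$ is a bijection with the following property. Suppose $\mathbf{s}=\langle s_1,\ldots,s_{n-1}\rangle\in\mathcal{F}^{(n\ldots 1)}$ and $T=\mathcal{B}(\mathbf{s})$, where $T$ has edges $\{e_1,\ldots,e_{n-1}\}$. Then $$\{|\mathrm{C\text{-}Index}(s_1)|,\ldots,|\mathrm{C\text{-}Index}(s_{n-1})|\}=\{|\mathrm{T\text{-}Index}(e_1)|,\ldots,|\mathrm{T\text{-}Index}(e_{n-1})|\}.$$
   Context: $\mathbf{S}_n$ is the symmetric group on $[n]=\{1,\ldots,n\}$; permutations are multiplied from left to right (in $p\cdot q$, $p$ is applied first). A transposition sequence over $\mathbf{S}_n$ is a finite sequence $\langle s_1,\ldots,s_m\rangle$ of transpositions; its product is $s_1\cdot s_2\cdots s_m$. It is identified with the labeled graph on vertex set $[n]$ having, for each $s_i=(x_i,y_i)$, an edge labeled $i$ between $x_i$ and $y_i$. $\mathcal{F}^{(n\ldots 1)}$ is the set of length $n-1$ transposition sequences over $\mathbf{S}_n$ with product the cycle $(n,\ldots,2,1)$ (mapping $n\mapsto n-1\mapsto\cdots\mapsto1\mapsto n$), and $\mathcal{F}^{(1\ldots n)}$ is the set of those with product $(1,2,\ldots,n)$. The graphs of all these sequences are trees (Dénes). $\mathcal{T}_n$ is the set of trees on $n$ vertices whose vertices are labeled with distinct labels from $[n]$. $\mathcal{D}:\mathcal{F}^{(n\ldots 1)}\to\mathcal{F}^{(1\ldots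 n)}$ sends a transposition sequence to its dual, defined as follows. For $\mathbf{s}=\langle s_1,\ldots,s_m\rangle$, regard a permutation $A$ as assigning to each mind $M$ the body $A(M)$, with $M$ said to be above $A(M)$. Let $A_0$ be the identity and let $A_k$ be obtained from $A_{k-1}$ by exchanging the bodies $x$ and $y$, where $s_k=(x,y)$ (so $A_k=s_1\cdots s_k$). The dual of $\mathbf{s}$ is $\langle s_1',\ldots,s_m'\rangle$, where for $s_k=(x,y)$ one puts $s_k'=(x',y')$ with $x'$ above $x$ and $y'$ above $y$ in $A_{k-1}$. $\mathcal{S}:\mathcal{F}^{(1\ldots n)}\to\mathcal{T}_n$ is defined on a tree with labeled vertices and edges as follows: the vertex $1$ keeps the label $1$; every other vertex $v$ is relabeled $1+w$, where $w$ is the label of the edge incident to $v$ that is closest to the vertex $1$ (the first edge on the path from $v$ to $1$); then the edge labels are erased. C-Index: for $\mathbf{s}=\langle s_1,\ldots,s_{n-1}\rangle$ over $\mathbf{S}_n$ that is a tree and $s_k=(x,y)$, the product of $\mathbf{s}$ is an $n$-cycle that can be written $(x,x_1,\ldots,x_a,y,y_1,\ldots,y_b)$; set $\mathrm{C\text{-}Index}(s_k)=\min(|\{x,x_1,\ldots,x_a\}|,|\{y,y_1,\ldots,y_b\}|)$. T-Index: for an edge $e$ of a tree, $\mathrm{T\text{-}Index}(e)=\min(|A|,|B|)$, where $A,B$ are the vertex sets of the two connected components obtained by removing $e$. *)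

(* Defs.v *)
(* Mathematical Components.  The symmetric group on [n], n = m.+1, is
   'S_m.+1 = {perm 'I_m.+1}: the element i of [n] is the ordinal of value i - 1.
   Edge labels 1, ..., n-1 are likewise the ordinals 'I_m, shifted by one.
   Products of permutations act from left to right: (p * q) x = q (p x). *)
From HB Require Import structures.
From mathcomp Require Import all_boot all_fingroup.

Set Implicit Arguments.
Unset Strict Implicit.
Unset Printing Implicit Defensive.

Local Open Scope group_scope.

Section Graphs.
Variable V : finType.

(* A graph on V is given by its set of edges, an edge being a 2-element set. *)
Definition graph := {set {set V}}.

Definition adj (G : graph) : rel V := [rel x y | [set x; y] \in G].

Definition simple_graph (G : graph) : Prop := forall e : {set V}, e \in G -> #|e| = 2.

Definition connected_graph (G : graph) : Prop :=
  forall x y, connect (adj G) x y.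

Definition acyclic_graph (G : graph) : Prop :=
  forall c : seq V, 2 < size c -> ~ ucycle (adj G) c.

Definition is_tree (G : graph) : Prop :=
  [/\ simple_graph G, connected_graph G & acyclic_graph G].

Definition components (G : graph) : {set {set V}} :=
  equivalence_partition (connect (adj G)) [set: V].

(* When G is a tree and e an edge of G, there are exactly two components; the
   index #|V| of the iterated minimum never contributes. *)
Definition T_index (G : graph) (e : {set V}) : nat :=
  \big[minn/#|V|]_(A in components (G :\ e)) #|A|.

End Graphs.

Section TranspositionSequences.
Variable m : nat.
Local Notation V := 'I_m.+1.

Definition writes_as (t : 'S_m.+1) (p : V * V) : bool :=
  (p.1 != p.2) && (t == tperm p.1 p.2).

Definition transposition (t : 'S_m.+1) : bool := [exists p, writes_as t p].

(* A way (x, y) of writing the transposition t.  What is built from it below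
   does not depend on the order of x and y. *)
Definition ends (t : 'S_m.+1) : V * V :=
  odflt (ord0, ord0) [pick p | writes_as t p].

Definition edge_of (t : 'S_m.+1) : {set V} := [set (ends t).1; (ends t).2].

Definition product (s : m.-tuple 'S_m.+1) : 'S_m.+1 := \prod_(t <- s) t.

Definition factorizations (c : 'S_m.+1) : {set m.-tuple 'S_m.+1} :=
  [set s : m.-tuple 'S_m.+1 | all transposition s && (product s == c)].

Definition cycle_up : 'S_m.+1 := perm (@ordS_inj m.+1).
Definition cycle_down : 'S_m.+1 := perm (@ord_pred_inj m.+1).

Definition F_up := factorizations cycle_up.
Definition F_down := factorizations cycle_down.

(* The permutation A_k; it maps a mind to the body below it. *)
Definition bodies (s : m.-tuple 'S_m.+1) (k : nat) : 'S_m.+1 :=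
  \prod_(t <- take k s) t.

Definition mind_above (A : 'S_m.+1) (x : V) : V := A^-1 x.

(* Position k : 'I_m stands for the (k+1)-st exchange, which takes place when
   the minds are distributed according to A_k. *)
Definition dual (s : m.-tuple 'S_m.+1) : m.-tuple 'S_m.+1 :=
  [tuple let: (x, y) := ends (tnth s k) in
         tperm (mind_above (bodies s k) x) (mind_above (bodies s k) y)
  | k < m].

Definition graph_of (s : m.-tuple 'S_m.+1) : graph V := [set edge_of t | t in s].

(* The edge labeled k is the first edge on a simple path from v to the root.
   As v :: p has no repetition, p has at most m items. *)
Definition first_edge (s : m.-tuple 'S_m.+1) (v : V) (k : 'I_m) : bool :=
  [exists l : 'I_m.+1, exists p : l.-tuple V,
    [&& path (adj (graph_of s)) v p, uniq (v :: p), last v p == ord0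
      & edge_of (tnth s k) == [set v; head v p]]].

(* [lift ord0 k] has value k.+1: it is the vertex label 1 + w when k stands for
   the edge label w. *)
Definition relabel (s : m.-tuple 'S_m.+1) (v : V) : V :=
  if v == ord0 then ord0
  else if [pick k | first_edge s v k] is Some k then lift ord0 k else ord0.

Definition shift_labels (s : m.-tuple 'S_m.+1) : graph V :=
  [set relabel s @: e | e : {set V} in graph_of s].

Definition B (s : m.-tuple 'S_m.+1) : graph V := shift_labels (dual s).

(* If the product of s is the cycle (x, x_1, ..., x_a, y, y_1, ..., y_b), the
   two arcs are [:: x; x_1; ...; x_a] and [:: y; y_1; ...; y_b]. *)
Definition C_index (s : m.-tuple 'S_m.+1) (k : 'I_m) : nat :=
  let: (x, y) := ends (tnth s k) in
  let c := fingraph.orbit (product s) x in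
  minn (size (arc c x y)) (size (arc c y x)).

End TranspositionSequences.

(* Main.v *)
(** Let [t] be the dual of [s].  Duality inverts the product and is an
    involution, so it identifies the factorizations of the two cycles.
    A product of transpositions moves points only within the components of its
    graph, so the graph of a factorization of a long cycle is connected; having
    [m] edges on [m.+1] vertices, it is a tree, and [relabel] is the bijection
    sending each non-root vertex to one plus the label of the edge towards its
    parent.  Thus [B s] is the graph of the conjugate of [t] by a permutation [r]
    fixing the root, and this conjugate can be read off [B s].
    Since [r] fixes the root, it is determined by the conjugated long cycle, which
    gives injectivity.  Conversely the edges of any tree, taken in any order,
    multiply to a long cycle, which is conjugate to the standard one by a
    permutation fixing the root; this gives surjectivity.
    Deleting the [k]-th transposition of [t] multiplies the product by the
    [k]-th transposition of [s], cutting the long cycle into the two arcs that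
    define the C-index.  Each arc stays connected, hence the arcs are the two
    components that define the T-index. *)
Require Import Defs.
From HB Require Import structures.
From mathcomp Require Import all_boot all_fingroup.

Set Implicit Arguments.
Unset Strict Implicit.
Unset Printing Implicit Defensive.

(** [minn] has no unit on [nat], so it is only made a commutative semigroup law; this allows
    [T_index_split] to reorder an iterated minimum. *)
HB.instance Definition _ := SemiGroup.isComLaw.Build nat minn minnA minnC.

(** * Rooted trees, parent functions and edge deletion *)

Section Trees.
Variable V : finType.
Implicit Types (G H : graph V) (r x y u v w : V) (p : V -> V) (d : V -> nat).

Lemma set2_inj (a b c d : V) :
  [set a; b] = [set c; d] -> (a = c /\ b = d) \/ (a = d /\ b = c).
Proof.
move=> eq_ab; have := set21 a b; rewrite eq_ab in_set2.
have := set22 a b; rewrite eq_ab in_set2.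
have := set21 c d; rewrite -eq_ab in_set2.
have := set22 c d; rewrite -eq_ab in_set2.
by do 4![case/orP=> /eqP ?]; subst; auto.
Qed.

Lemma adj_sym G : symmetric (adj G).
Proof. by move=> x y; rewrite /adj /= setUC. Qed.

Lemma connect_adj_sym G : connect_sym (adj G).
Proof. exact/sym_connect_sym/adj_sym. Qed.

Lemma connect_adjS G H x y :
  G \subset H -> connect (adj G) x y -> connect (adj H) x y.
Proof.
by move=> /subsetP sGH; apply: connect_sub => u v Guv; apply/connect1/sGH.
Qed.

Lemma acyclic_graphS G H : G \subset H -> acyclic_graph H -> acyclic_graph G.
Proof.
move=> /subsetP sGH acH c c2 /andP[cyc uc]; apply: (acH c c2); rewrite /ucycle uc andbT.
by apply: sub_cycle cyc => x y; apply: sGH.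
Qed.

(** A simple path from [x] to [y] avoiding the edge would close up with it to a cycle. *)
Lemma acyclic_bridge G x y : acyclic_graph G -> x != y -> [set x; y] \in G ->
  ~~ connect (adj (G :\ [set x; y])) x y.
Proof.
move=> acG neq_xy Gxy; apply/negP => /connectP[q0 /shortenP[q path_q uniq_q _] last_q].
have sub_adj : subrel (adj (G :\ [set x; y])) (adj G).
  by move=> u v /setD1P[].
apply: (acG (x :: q)).
  (* The cycle has more than two vertices: a path of length one would use the deleted edge
     itself. *)
  case: q path_q last_q {uniq_q} => [_ /= eq_xy|z [|//]]; first by rewrite eq_xy eqxx in neq_xy.
  by rewrite /= andbT => /[swap] <-; rewrite /adj /= setD11.
rewrite /ucycle uniq_q andbT /= rcons_path (sub_path sub_adj) //= -last_q.
by rewrite adj_sym.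
Qed.

(* [p] gives the parent of each non-root vertex; [d] is any potential that
   decreases towards the root and excludes loops of [p]. *)
Definition parents G r p d :=
  forall v, v != r -> [set v; p v] \in G /\ d (p v) < d v.

Definition only_parents G r p :=
  forall e, e \in G -> exists2 v, v != r & e = [set v; p v].

(** Here [d] is the distance to the root, and the parent is any neighbour strictly closer to it. *)
Lemma connected_parents G r : connected_graph G -> exists p d, parents G r p d.
Proof.
move=> conG; pose P v l := [exists q : l.-tuple V, path (adj G) v q && (last v q == r)].
have exP v : exists l, P v l.
  have /connectP[q path_q last_q] := conG v r.
  by exists (size q); apply/existsP; exists (in_tuple q); rewrite path_q last_q /=.
pose d v := ex_minn (exP v).
have step v : v != r -> exists w, ([set v; w] \in G) && (d w < d v).
  move=> neq_vr; rewrite {2}/d; case: ex_minnP => l /existsP[q /andP[path_q last_q]] _.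
  case: q path_q last_q => [[|w q] /= szq]; first by rewrite (negPf neq_vr).
  case/andP=> Gvw path_q last_q; exists w; apply/andP; split=> //.
  rewrite /d; case: ex_minnP => l' _ min_l'.
  rewrite -(eqP szq) ltnS; apply: min_l'.
  by apply/existsP; exists (in_tuple q); rewrite /= path_q last_q.
pose p v := odflt v [pick w | ([set v; w] \in G) && (d w < d v)].
exists p, d => v /step[w vw]; rewrite /p; case: pickP => [u /andP[]//|/(_ w)].
by rewrite vw.
Qed.

(** Two distinct vertices with the same parent edge would be parents of each other, so that [d]
    would decrease both ways. *)
Lemma parent_edge_inj G r p d : parents G r p d ->
  {in predC1 r &, injective (fun v => [set v; p v])}.
Proof.
move=> par v w /= vr wr /set2_inj[[]//|[vpw pvw]].
have [_ ltv] := par v vr; have [_ ltw] := par w wr.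
by rewrite pvw in ltv; rewrite -vpw in ltw; have := ltn_trans ltv ltw; rewrite ltnn.
Qed.

Lemma card_parent_edges G r p d : parents G r p d ->
  #|[set [set v; p v] | v in predC1 r]| = #|V|.-1.
Proof. by move/parent_edge_inj/card_in_imset->; rewrite cardC1. Qed.

(** The parent edges are distinct and already number [#|V|.-1], so they exhaust the graph. *)
Lemma leq_card_only_parents G r p d :
  parents G r p d -> #|G| <= #|V|.-1 -> only_parents G r p /\ #|G| = #|V|.-1.
Proof.
move=> par leG; have cardP := card_parent_edges par.
have sub : [set [set v; p v] | v in predC1 r] \subset G.
  by apply/subsetP=> _ /imsetP[v vr ->]; case: (par v vr).
have eqG : [set [set v; p v] | v in predC1 r] = G.
  by apply/eqP; rewrite eqEcard sub cardP.
split=> [e|]; last by rewrite -cardP eqG.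
by rewrite -eqG => /imsetP[v vr ->]; exists v.
Qed.

Lemma only_parents_adj G r p u v : only_parents G r p -> adj G u v ->
  (u != r /\ v = p u) \/ (v != r /\ u = p v).
Proof.
by move=> onlyp /onlyp[w wr /set2_inj[[-> ->]|[-> ->]]]; auto.
Qed.

(* A vertex of a cycle maximizing [d] would have its parent as both of its
   neighbours on the cycle. *)
Lemma parents_acyclic G r p d :
  parents G r p d -> only_parents G r p -> acyclic_graph G.
Proof.
move=> par onlyp c c2 /andP[cyc uc].
have [x0 xc0] : exists x, x \in c.
  by case: c c2 {cyc uc} => // x ?; exists x; rewrite mem_head.
case: (@arg_maxnP _ x0 (mem c) d xc0) => v vc maxv.
have up w : w \in c -> adj G v w -> w = p v.
  move=> wc /(only_parents_adj onlyp)[[]//|[wr vpw]].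
  by have [_] := par w wr; rewrite -vpw ltnNge [d w <= d v](maxv w wc).
have [i c' def_c] := rot_to vc.
have {}cyc : path.cycle (adj G) (v :: c') by rewrite -def_c rot_cycle.
have {}uc : uniq (v :: c') by rewrite -def_c rot_uniq.
have mem_c : {subset c' <= c}.
  by move=> w wc'; rewrite -(mem_rot i) def_c inE wc' orbT.
have {}c2 : 1 < size c' by rewrite -ltnS -(size_rot i c) def_c in c2.
case/lastP: c' mem_c cyc uc c2 {def_c} => [//|[|a q] b] // mem_c cyc uc _.
move: cyc; rewrite /= rcons_path last_rcons => /andP[va /andP[_]].
rewrite adj_sym => vb.
have eqa : a = p v by apply: up va; apply: mem_c; rewrite mem_head.
have eqb : b = p v by apply: up vb; apply: mem_c; rewrite mem_rcons mem_head.
by move: uc; rewrite /= eqa eqb mem_rcons mem_head andbF.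
Qed.

(* Leaving [v] by an edge other than the one to its parent, a simple path
   can only move away from the root. *)
Lemma simple_path_parent G r p d v q : parents G r p d -> only_parents G r p ->
  v != r -> path (adj G) v q -> uniq (v :: q) -> last v q = r ->
  head v q = p v.
Proof.
move=> par onlyp vr.
have away : forall q' u w, u = p w -> w != r -> path (adj G) w q' ->
    uniq [:: u, w & q'] -> last w q' != r.
  elim=> [//|x q' IH] u w uw wr /= /andP[wx path_q'] /and3P[].
  rewrite !inE !negb_or => /and3P[_ ux uq'] /andP[wx' wq'] uq.
  have [[_ xw]|[xr wx'']] := only_parents_adj onlyp wx.
    by rewrite xw -uw eqxx in ux.
  apply: (IH w x wx'' xr path_q').
  by rewrite /= inE negb_or wx' wq'.
case: q => [_ _ /= eq_vr|w q]; first by rewrite eq_vr eqxx in vr.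
rewrite [head _ _]/=; case/andP=> vw path_q uq last_q.
have [[]//|[wr vpw]] := only_parents_adj onlyp vw.
by have := away q v w vpw wr path_q uq; rewrite [last _ _]last_q eqxx.
Qed.

Lemma connected_simple_path G x y : connected_graph G ->
  exists q, [/\ path (adj G) x q, uniq (x :: q) & last x q = y].
Proof.
move=> /(_ x y)/connectP[q0 /shortenP[q path_q uniq_q _] ->].
by exists q.
Qed.

Lemma parents_connect G r p d e v : parents G r p d ->
  (forall w, w != r -> e <> [set w; p w]) -> connect (adj (G :\ e)) v r.
Proof.
move=> par ne; have [n le_n] := ubnP (d v); elim: n v le_n => // n IH v le_n.
have [->//|vr] := eqVneq v r; have [Gv dv] := par v vr.
apply: (@connect_trans _ _ (p v)); last by apply: IH; apply: leq_trans dv _.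
by apply/connect1; rewrite /adj /= in_setD1 Gv andbT eq_sym; apply/eqP/ne.
Qed.

(** An edge other than the parent edges could be deleted with every vertex still climbing to the
    root, yet in a tree each edge is a bridge. *)
Lemma tree_only_parents G r p d :
  is_tree G -> parents G r p d -> only_parents G r p.
Proof.
move=> [simG conG acG] par e Ge.
case: (boolP [exists v, (v != r) && (e == [set v; p v])]).
  by case/existsP=> v /andP[vr /eqP ev]; exists v.
move=> none; have /cards2P[x [y [neq_xy def_e]]] : #|e| == 2 by rewrite simG.
have ne w : w != r -> e <> [set w; p w].
  move=> wr ew; case/negP: none; apply/existsP; exists w.
  by rewrite wr ew eqxx.
have /negP[] : ~~ connect (adj (G :\ e)) x y.
  by rewrite def_e; apply: acyclic_bridge => //; rewrite -def_e.
apply: (@connect_trans _ _ r); first exact: (parents_connect _ par).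
by rewrite connect_adj_sym; apply: (parents_connect _ par).
Qed.

Lemma T_index_split G e (A B : {set V}) (a b : V) :
  let R := connect (adj (G :\ e)) in
  A :|: B = setT -> a \in A -> b \in B -> ~~ R a b ->
  {in A &, forall x y, R x y} -> {in B &, forall x y, R x y} ->
  T_index G e = minn #|A| #|B|.
Proof.
move=> R AB aA bB nab RA RB.
have symR x y : R x y = R y x by apply: connect_adj_sym.
have sep x y : x \in A -> y \in B -> ~~ R x y.
  move=> xA yB; apply: contra nab => xy.
  apply: connect_trans (RA a x aA xA) _; apply: connect_trans xy _; exact: RB.
have inAB x : (x \in A) || (x \in B) by rewrite -in_setU AB inE.
have classA x : x \in A -> [set y in [set: V] | R x y] = A.
  move=> xA; apply/setP=> y; rewrite !inE /=; apply/idP/idP; last exact: RA.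
  by apply: contraLR => yA; have := inAB y; rewrite (negPf yA) => /(sep x y xA).
have classB x : x \in B -> [set y in [set: V] | R x y] = B.
  move=> xB; apply/setP=> y; rewrite !inE /=; apply/idP/idP; last exact: RB.
  apply: contraLR => yB; have := inAB y; rewrite (negPf yB) orbF => yA.
  by rewrite symR; apply: sep.
have eqP : components (G :\ e) = [set A; B].
  apply/setP=> C; rewrite in_set2; apply/imsetP/orP.
    by case=> x _ ->; case/orP: (inAB x) => [/classA|/classB] ->; auto.
  by case=> /eqP->; [exists a; rewrite ?classA | exists b; rewrite ?classB].
have neqAB : A != B.
  by apply: contraNneq nab => eqAB; apply: RA => //; rewrite eqAB.
rewrite /T_index eqP -big_enum (perm_big [:: A; B]) /=; last first.
  apply: uniq_perm; rewrite ?enum_uniq //= ?inE ?neqAB // => C.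
  by rewrite mem_enum !inE.
by rewrite !big_cons big_nil (minn_idPl (max_card _)).
Qed.

End Trees.

(** * Transpositions as edges *)

Section TranspositionSequences.
Variable m : nat.
Local Notation V := 'I_m.+1.
Local Open Scope group_scope.
Implicit Types (t : 'S_m.+1) (r pi : 'S_m.+1) (ts : seq 'S_m.+1)
  (s : m.-tuple 'S_m.+1) (x y v : V) (k : 'I_m).

Lemma transpositionP t :
  reflect (exists x y, x != y /\ t = tperm x y) (transposition t).
Proof.
apply: (iffP existsP) => [[[x y] /andP[/= neq_xy /eqP->]]|[x [y [neq_xy ->]]]].
  by exists x, y.
by exists (x, y); rewrite /writes_as neq_xy /=.
Qed.

Lemma ends_tperm x y : x != y ->
  ends (tperm x y) = (x, y) \/ ends (tperm x y) = (y, x).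
Proof.
move=> neq_xy; rewrite /ends; case: pickP => [[a b]|/(_ (x, y))]; last first.
  by rewrite /writes_as neq_xy eqxx.
case/andP=> /= neq_ab /eqP eq_t; have := tpermL x y; rewrite eq_t.
case: tpermP => [-> ->|-> ->|_ _ eq_xy]; auto.
by rewrite eq_xy eqxx in neq_xy.
Qed.

Lemma ends_transposition t : transposition t ->
  (ends t).1 != (ends t).2 /\ t = tperm (ends t).1 (ends t).2.
Proof.
case/transpositionP=> x [y [neq_xy ->]].
by case: (ends_tperm neq_xy) => -> //=; rewrite eq_sym tpermC.
Qed.

Lemma edge_of_tperm x y : x != y -> edge_of (tperm x y) = [set x; y].
Proof. by rewrite /edge_of => /ends_tperm[]-> //=; rewrite setUC. Qed.

Lemma edge_of_inj : {in @transposition m &, injective (@edge_of m)}.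
Proof.
move=> t1 t2 /transpositionP[x [y [xy ->]]] /transpositionP[z [w [zw ->]]].
rewrite !edge_of_tperm // => /set2_inj[[-> ->]//|[-> ->]].
exact: tpermC.
Qed.

Lemma transpositionV t : transposition t -> t^-1 = t.
Proof. by case/transpositionP=> x [y [_ ->]]; rewrite tpermV. Qed.

Lemma transpositionJ t r : transposition (t ^ r) = transposition t.
Proof.
suff imp (u w : 'S_m.+1) : transposition u -> transposition (u ^ w).
  by apply/idP/idP => [/(imp _ r^-1)|/imp//]; rewrite conjgK.
case/transpositionP=> x [y [neq_xy ->]]; apply/transpositionP.
by exists (w x), (w y); rewrite tpermJ (inj_eq perm_inj).
Qed.

Lemma edge_ofJ t r : transposition t -> edge_of (t ^ r) = r @: edge_of t.
Proof.
case/transpositionP=> x [y [neq_xy ->]].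
by rewrite tpermJ !edge_of_tperm ?(inj_eq perm_inj) // imsetU1 imset_set1.
Qed.

(** * Orbits of a product and components of its graph *)

Definition edges ts : graph V := [set edge_of t | t in ts].

Lemma edges_cons t ts : edges (t :: ts) = edge_of t |: edges ts.
Proof.
apply/setP=> e; rewrite in_setU1; apply/imsetP/orP.
  case=> u; rewrite inE => /predU1P[->|uts] ->; first by left.
  by right; apply: imset_f.
case=> [/eqP->|/imsetP[u uts ->]]; first by exists t; rewrite ?mem_head.
by exists u; rewrite // inE uts orbT.
Qed.

Lemma simple_edges ts : all (@transposition m) ts -> simple_graph (edges ts).
Proof.
move=> /allP tr e /imsetP[t /tr/transpositionP[x [y [neq_xy ->]]] ->].
by rewrite edge_of_tperm // cards2 neq_xy.
Qed.

Lemma connect_prod ts x : all (@transposition m) ts ->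
  connect (adj (edges ts)) x ((\prod_(t <- ts) t) x).
Proof.
elim: ts x => [|t ts IH] x /=; first by rewrite big_nil perm1.
case/andP=> tr_t tr_ts; rewrite big_cons permM edges_cons.
apply: (@connect_trans _ _ (t x)); last first.
  by apply: connect_adjS (IH _ tr_ts); apply: subsetUr.
case/transpositionP: tr_t => a [b [neq_ab ->]].
case: tpermP => [-> | -> | _ _]; last exact: connect0.
  by apply/connect1; rewrite /adj /= edge_of_tperm // setU11.
by apply/connect1; rewrite /adj /= edge_of_tperm // setUC setU11.
Qed.

Lemma connect_porbit ts x y : all (@transposition m) ts ->
  y \in porbit (\prod_(t <- ts) t) x -> connect (adj (edges ts)) x y.
Proof.
move=> tr /porbitP[i ->]; elim: i => [|i IH]; first by rewrite expg0 perm1.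
by rewrite expgSr permM; apply: connect_trans IH (connect_prod _ tr).
Qed.

(* Each transposition joins two orbits of the product of those after it, since
   its ends are not connected by the later edges. *)
Lemma acyclic_card_porbits ts : all (@transposition m) ts ->
  uniq [seq edge_of t | t <- ts] -> acyclic_graph (edges ts) ->
  (#|porbits (\prod_(t <- ts) t)| + size ts)%N = m.+1.
Proof.
elim: ts => [|t ts IH] /=.
  move=> _ _ _; rewrite big_nil addn0 /porbits card_imset ?card_ord //.
  by move=> x y /eqP; rewrite eq_porbit_mem => /porbitP[i ->]; rewrite expg1n perm1.
case/andP=> tr_t tr_ts /andP[t_ts uniq_ts] ac.
have sub : edges ts \subset edges (t :: ts) by rewrite edges_cons subsetUr.
have eq_edges : edges (t :: ts) :\ edge_of t = edges ts.
  rewrite edges_cons setU1K //; apply: contra t_ts => /imsetP[u uts ->].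
  exact: map_f.
have {}IH := IH tr_ts uniq_ts (acyclic_graphS sub ac); rewrite big_cons.
case/transpositionP: tr_t t_ts eq_edges ac => x [y [neq_xy ->]].
rewrite edge_of_tperm // => t_ts eq_edges ac {sub}.
have xy_in : [set x; y] \in edges (tperm x y :: ts).
  by rewrite edges_cons edge_of_tperm // setU11.
have sep : x \notin porbit (\prod_(t <- ts) t) y.
  apply: contra (acyclic_bridge ac neq_xy xy_in); rewrite eq_edges porbit_sym.
  exact: connect_porbit.
have := porbits_mul_tperm (\prod_(t <- ts) t) x y.
(* Both tests in [porbits_mul_tperm] hold, adding 2 on one side and 1 on the other: one orbit is
   lost. *)
rewrite /= sep neq_xy -[(true.*2)%N]/(1 + 1)%N addnA => /addIn card_eq.
by rewrite -card_eq addn1 addSnnS in IH.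
Qed.

(** * Long cycles *)

Definition full_cycle pi := forall x y, y \in porbit pi x.

Lemma full_cycleJ pi r : full_cycle pi -> full_cycle (pi ^ r).
Proof.
move=> fc x y; have /porbitP[i eqi] := fc (r^-1 x) (r^-1 y); apply/porbitP.
by exists i; rewrite -conjXg /conjg !permM -eqi permKV.
Qed.

Lemma full_cycle_card pi : #|porbits pi| = 1%N -> full_cycle pi.
Proof.
move/eqP/cards1P=> [A eqA] x y; rewrite -eq_porbit_mem.
have inA z : porbit pi z = A by apply/set1P; rewrite -eqA imset_f.
by rewrite !inA.
Qed.

Lemma cycle_upX (i : nat) : (cycle_up m ^+ i) ord0 = i %% m.+1 :> nat.
Proof.
elim: i => [|i IH]; first by rewrite expg0 perm1 mod0n.
by rewrite expgSr permM permE /= IH -addn1 modnDml addn1.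
Qed.

Lemma cycle_up_ord x : (cycle_up m ^+ x) ord0 = x.
Proof. by apply: val_inj; rewrite /= cycle_upX modn_small. Qed.

Lemma cycle_up_full : full_cycle (cycle_up m).
Proof.
have in0 z : z \in porbit (cycle_up m) ord0.
  by apply/porbitP; exists z; rewrite cycle_up_ord.
move=> x y; rewrite -eq_porbit_mem; apply/eqP.
have/eqP-> : porbit (cycle_up m) x == porbit (cycle_up m) ord0.
  by rewrite eq_porbit_mem.
by apply/eqP; rewrite eq_porbit_mem.
Qed.

Lemma cycle_upV : (cycle_up m)^-1 = cycle_down m.
Proof.
apply/eqP; rewrite eq_invg_mul; apply/eqP/permP=> x.
by rewrite permM !permE ordSK.
Qed.

(** The conjugator lists the orbit of the root, sending [x] to [(pi ^+ x) ord0]; exponent 0 gives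
    the fixed root. *)
Lemma conj_full_cycle pi : full_cycle pi ->
  exists r, r ord0 = ord0 /\ cycle_up m ^ r = pi.
Proof.
move=> fc; pose f x := (pi ^+ x) ord0.
have card_orb : #|porbit pi ord0| = m.+1.
  rewrite -[RHS]card_ord -cardsT; congr #|pred_of_set _|.
  by apply/setP=> z; rewrite inE fc.
have onto y : y \in codom f.
  have := fc ord0 y; rewrite porbit_traject card_orb => /trajectP[i lt_i ->].
  by apply/codomP; exists (Ordinal lt_i); rewrite /f permX.
have inj_f : injective f.
  apply/injectiveP/card_uniqP; rewrite size_codom; apply: eq_card => y.
  by rewrite onto.
have piX : (pi ^+ m.+1) ord0 = ord0.
  by have := iter_porbit pi ord0; rewrite card_orb permX.
exists (perm inj_f); split; first by rewrite permE /f expg0 perm1.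
apply/permP=> y; have /codomP[x ->] := onto y.
rewrite -[f x](permE inj_f) /conjg !permM permK !permE /f /=.
(* The successor wraps around only at [x = m], where [piX] closes the cycle. *)
have [lt_x|ge_x] := ltnP x m.
  by rewrite modn_small ?ltnS // expgSr permM.
have eq_x : x = m :> nat by apply/eqP; rewrite eqn_leq ge_x -ltnS ltn_ord.
by rewrite eq_x modnn expg0 perm1 -[LHS]piX expgSr permM.
Qed.


(** * Sequences whose graph is a tree, and their relabeling *)

Definition trees s :=
  all (@transposition m) s /\ connected_graph (graph_of s).

Lemma transposition_tnth s k : all (@transposition m) s -> transposition (tnth s k).
Proof. by move/allP; apply; apply: mem_tnth. Qed.

Lemma graph_of_tnth s : graph_of s = [set edge_of (tnth s k) | k : 'I_m].
Proof.
apply/setP=> e; apply/imsetP/imsetP => [[t /tnthP[k ->] ->]|[k _ ->]].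
  by exists k.
by exists (tnth s k); rewrite ?mem_tnth.
Qed.

Lemma full_cycle_trees s :
  all (@transposition m) s -> full_cycle (product s) -> trees s.
Proof.
by move=> tr fc; split=> // x y; apply: (@connect_porbit s) => //; apply: fc.
Qed.

(** The [m] positions give at most [m] edges while the parent edges are already [m]; equality forces
    both conclusions. *)
Lemma trees_parents s p d : trees s -> parents (graph_of s) ord0 p d ->
  only_parents (graph_of s) ord0 p
  /\ injective (fun k => edge_of (tnth s k)).
Proof.
move=> [tr con] par.
have le_m : #|graph_of s| <= #|V|.-1.
  by rewrite graph_of_tnth (leq_trans (leq_imset_card _ _)) // !card_ord.
have [onlyp card_m] := leq_card_only_parents par le_m; split=> //.
suff /imset_injP inj : #|[set edge_of (tnth s k) | k in 'I_m]| == #|'I_m|.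
  by move=> k l; apply: inj.
by rewrite -graph_of_tnth card_m !card_ord.
Qed.

Lemma trees_edge_inj s : trees s -> injective (fun k => edge_of (tnth s k)).
Proof.
move=> ts; have [p [d par]] := connected_parents ord0 ts.2.
by case: (trees_parents ts par).
Qed.

Lemma trees_uniq s : trees s -> uniq [seq edge_of t | t <- s].
Proof.
move/trees_edge_inj=> inj; rewrite -(map_tnth_enum s) -map_comp.
by rewrite map_inj_uniq ?enum_uniq.
Qed.

Lemma trees_is_tree s : trees s -> is_tree (graph_of s).
Proof.
move=> ts; have [p [d par]] := connected_parents ord0 ts.2.
have [onlyp _] := trees_parents ts par.
split; [exact: simple_edges ts.1 | exact: ts.2 | exact: parents_acyclic par onlyp].
Qed.

(** Each of the [m] factors merges two of the initial [m.+1] orbits, so a single one remains,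
    whatever the order of the edges. *)
Lemma trees_full_cycle s : trees s -> full_cycle (product s).
Proof.
move=> ts; apply: full_cycle_card; have [_ _ ac] := trees_is_tree ts.
have := acyclic_card_porbits ts.1 (trees_uniq ts) ac.
by rewrite size_tuple => card_eq; apply: (@addIn m); apply: etrans card_eq _.
Qed.

(** Every simple path to the root starts towards the parent, so the choice of path in [first_edge]
    does not matter. *)
Lemma first_edgeE s p d v k : trees s -> parents (graph_of s) ord0 p d ->
  v != ord0 -> first_edge s v k = (edge_of (tnth s k) == [set v; p v]).
Proof.
move=> ts par v0; have [onlyp _] := trees_parents ts par.
apply/existsP/idP => [[l /existsP[q /and4P[path_q uniq_q /eqP last_q]]]|/eqP edge_k].
  by rewrite (simple_path_parent par onlyp v0 path_q uniq_q last_q).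
have [q [path_q uniq_q last_q]] := connected_simple_path v ord0 ts.2.
have lt_q : size q < m.+1.
  by have := max_card (mem (v :: q)); rewrite (card_uniqP uniq_q) card_ord.
exists (Ordinal lt_q); apply/existsP; exists (in_tuple q).
rewrite path_q uniq_q last_q eqxx /= edge_k.
by rewrite (simple_path_parent par onlyp v0 path_q uniq_q last_q).
Qed.

Lemma relabel0 s : relabel s ord0 = ord0.
Proof. by rewrite /relabel eqxx. Qed.

(** The parent edge sits at some position, so the default [ord0] of [relabel] is never reached away
    from the root. *)
Lemma relabel_edge s p d v : trees s -> parents (graph_of s) ord0 p d ->
  v != ord0 ->
  exists2 k, relabel s v = lift ord0 k & edge_of (tnth s k) = [set v; p v].
Proof.
move=> ts par v0; rewrite /relabel (negPf v0).
case: pickP => [k|none].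
  by rewrite (first_edgeE k ts par v0) => /eqP edge_k; exists k.
have [] := par v v0; rewrite graph_of_tnth => /imsetP[k _ edge_k] _.
by have := none k; rewrite (first_edgeE k ts par v0) edge_k eqxx.
Qed.

Lemma relabel_inj s : trees s -> injective (relabel s).
Proof.
move=> ts v w; have [p [d par]] := connected_parents ord0 ts.2.
have [->|v0] := eqVneq v ord0; have [->|w0] := eqVneq w ord0 => //.
- by have [k -> _] := relabel_edge ts par w0; rewrite relabel0.
- by have [k -> _] := relabel_edge ts par v0; rewrite relabel0.
have [k -> edge_k] := relabel_edge ts par v0.
have [l -> edge_l] := relabel_edge ts par w0.
by move/lift_inj=> eq_kl; apply: (parent_edge_inj par v0 w0); rewrite /= -edge_k -edge_l eq_kl.
Qed.

(** * Relabeling as conjugation *)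

Definition conj_seq s r : m.-tuple 'S_m.+1 := map_tuple (conjg^~ r) s.

Lemma tnth_conj_seq s r k : tnth (conj_seq s r) k = tnth s k ^ r.
Proof. exact: tnth_map. Qed.

Lemma prod_conj ts r :
  \prod_(t <- map (conjg^~ r) ts) t = (\prod_(t <- ts) t) ^ r.
Proof.
rewrite big_map; elim: ts => [|t ts IH]; first by rewrite !big_nil conj1g.
by rewrite !big_cons IH conjMg.
Qed.

Lemma product_conj s r : product (conj_seq s r) = product s ^ r.
Proof. exact: prod_conj. Qed.

Lemma bodies_conj s r k : bodies (conj_seq s r) k = bodies s k ^ r.
Proof. by rewrite /bodies -map_take prod_conj. Qed.

Lemma transposition_conj s r :
  all (@transposition m) (conj_seq s r) = all (@transposition m) s.
Proof. by rewrite all_map; apply: eq_all => t; apply: transpositionJ. Qed.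

Lemma graph_of_conj s r : all (@transposition m) s ->
  graph_of (conj_seq s r) = [set r @: e | e : {set V} in graph_of s].
Proof.
move=> tr; rewrite !graph_of_tnth -imset_comp; apply: eq_imset => k.
by rewrite tnth_conj_seq edge_ofJ // transposition_tnth.
Qed.

Lemma trees_conj s r : trees s -> trees (conj_seq s r).
Proof.
move=> ts; apply: full_cycle_trees; first by rewrite transposition_conj ts.1.
by rewrite product_conj; apply/full_cycleJ/trees_full_cycle.
Qed.

Lemma relabel_conj s r v : trees s -> r ord0 = ord0 ->
  relabel (conj_seq s r) (r v) = relabel s v.
Proof.
move=> ts r0; have [p [d par]] := connected_parents ord0 ts.2.
have [->|v0] := eqVneq v ord0; first by rewrite r0 !relabel0.
have imset_edge w : r @: [set w; p w] = [set r w; r (p w)].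
  by rewrite imsetU1 imset_set1.
(* Parents and potential are transported along [r], while positions of edges are unchanged. *)
have par' : parents (graph_of (conj_seq s r)) ord0 (r \o p \o r^-1) (d \o r^-1).
  move=> w w0 /=; have w0' : r^-1 w != ord0.
    by apply: contra w0 => /eqP eqw; rewrite -(permKV r w) eqw r0.
  have [Gw dw] := par _ w0'; rewrite permK; split=> //.
  by rewrite -{1}(permKV r w) -imset_edge graph_of_conj ?ts.1 // imset_f.
have rv0 : r v != ord0 by rewrite -r0 (inj_eq perm_inj).
have [k -> edge_k] := relabel_edge ts par v0.
have [l -> edge_l] := relabel_edge (trees_conj r ts) par' rv0.
congr (lift _ _); apply: (trees_edge_inj ts); rewrite edge_k.
apply: (imset_inj (@perm_inj _ r)); rewrite imset_edge.
move: edge_l; rewrite tnth_conj_seq edge_ofJ ?transposition_tnth ?ts.1 //.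
by rewrite /= permK.
Qed.

(** The permutation [r] is [relabel s] itself; by [relabel_conj], each vertex of the conjugated
    sequence then carries its own label. *)
Lemma shift_labels_conj s : trees s -> exists r,
  [/\ r ord0 = ord0, shift_labels s = graph_of (conj_seq s r)
    & relabel (conj_seq s r) =1 id].
Proof.
move=> ts; pose r := perm (relabel_inj ts).
have r0 : r ord0 = ord0 by rewrite permE relabel0.
exists r; split=> // [|v].
  rewrite graph_of_conj ?ts.1 //; apply: eq_imset => e.
  by apply: eq_imset => v; rewrite permE.
by rewrite -(permKV r v) relabel_conj // permKV -[in RHS](permKV r v) [RHS]permE.
Qed.

(** When labels are trivial, position [k] must hold the parent edge of [lift ord0 k], and one parent
    function serves the common graph. *)
Lemma relabel_id_inj s1 s2 : trees s1 -> trees s2 ->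
  relabel s1 =1 id -> relabel s2 =1 id -> graph_of s1 = graph_of s2 -> s1 = s2.
Proof.
move=> ts1 ts2 id1 id2 eqG; have [p [d par]] := connected_parents ord0 ts1.2.
have edgeE s k : trees s -> relabel s =1 id -> parents (graph_of s) ord0 p d ->
    edge_of (tnth s k) = [set lift ord0 k; p (lift ord0 k)].
  move=> ts ids pars; have k0 : lift ord0 k != ord0 by rewrite eq_sym neq_lift.
  have [l] := relabel_edge ts pars k0.
  by rewrite ids => /lift_inj->.
apply: eq_from_tnth => k; apply: edge_of_inj.
- exact: (transposition_tnth k ts1.1).
- exact: (transposition_tnth k ts2.1).
by rewrite (edgeE s1) // (edgeE s2) // -eqG.
Qed.

(** The parent edge of [lift ord0 k] is placed at position [k]. *)
Lemma tree_relabel_id (T : graph V) : is_tree T ->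
  exists s, [/\ trees s, graph_of s = T & relabel s =1 id].
Proof.
move=> treeT; have [_ conT _] := treeT.
have [p [d par]] := connected_parents ord0 conT.
have onlyp := tree_only_parents treeT par.
pose s := [tuple tperm (lift ord0 k) (p (lift ord0 k)) | k < m].
have neq_p v : v != ord0 -> v != p v.
  by move=> v0; have [_] := par v v0; apply: contraTneq => <-; rewrite ltnn.
have neq_lp k : lift ord0 k != p (lift ord0 k).
  by apply: neq_p; rewrite eq_sym neq_lift.
have edge_s k : edge_of (tnth s k) = [set lift ord0 k; p (lift ord0 k)].
  by rewrite tnth_mktuple edge_of_tperm.
have graph_s : graph_of s = T.
  apply/setP=> e; rewrite graph_of_tnth; apply/imsetP/idP => [[k _ ->]|].
    by rewrite edge_s; case: (par (lift ord0 k)); rewrite // eq_sym neq_lift.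
  case/onlyp=> v; rewrite eq_sym => /unlift_some[k -> _] ->.
  by exists k; rewrite ?edge_s.
have ts : trees s.
  split; last by rewrite graph_s.
  apply/allP=> _ /tnthP[k ->]; rewrite tnth_mktuple.
  by apply/transpositionP; exists (lift ord0 k), (p (lift ord0 k)).
exists s; split=> // v.
have [->|v0] := eqVneq v ord0; first exact: relabel0.
have par_s : parents (graph_of s) ord0 p d by rewrite graph_s.
have [k -> edge_k] := relabel_edge ts par_s v0.
apply: (parent_edge_inj par _ v0); first by rewrite inE eq_sym neq_lift.
by rewrite /= -edge_s.
Qed.

(** * Duality *)

Lemma dual_tnth s k : all (@transposition m) s ->
  tnth (dual s) k = tnth s k ^ (bodies s k)^-1.
Proof.
move=> tr; rewrite tnth_mktuple.
have [_ eq_t] := ends_transposition (transposition_tnth k tr).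
by rewrite {2}eq_t tpermJ; case: (ends _).
Qed.

Lemma bodiesS s k : bodies s k.+1 = bodies s k * tnth s k.
Proof.
rewrite /bodies (take_nth 1) ?size_tuple // -cats1 big_cat big_seq1 /=.
by rewrite (tnth_nth 1).
Qed.

Lemma bodies0 s : bodies s 0 = 1.
Proof. by rewrite /bodies take0 big_nil. Qed.

Lemma bodies_all s : bodies s m = product s.
Proof. by rewrite /bodies take_oversize // size_tuple. Qed.

Lemma transposition_dual s :
  all (@transposition m) s -> all (@transposition m) (dual s).
Proof.
move=> tr; apply/allP=> _ /tnthP[k ->].
by rewrite dual_tnth // transpositionJ transposition_tnth.
Qed.

(** With [A] the product so far and [t] the next factor, [A^-1 * (A * t * A^-1) = t * A^-1], which
    is [(A * t)^-1]. *)
Lemma bodies_dual s i : all (@transposition m) s -> i <= m ->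
  bodies (dual s) i = (bodies s i)^-1.
Proof.
move=> tr; elim: i => [|i IH] lt_im; first by rewrite !bodies0 invg1.
pose k := Ordinal lt_im.
rewrite (bodiesS (dual s) k) (bodiesS s k) IH 1?ltnW // dual_tnth // invMg.
by rewrite (transpositionV (transposition_tnth k tr)) /conjg invgK !mulgA mulVg mul1g.
Qed.

Lemma product_dual s : all (@transposition m) s -> product (dual s) = (product s)^-1.
Proof. by move=> tr; rewrite -!bodies_all bodies_dual. Qed.

Lemma dualK s : all (@transposition m) s -> dual (dual s) = s.
Proof.
move=> tr; apply: eq_from_tnth => k.
rewrite dual_tnth ?transposition_dual // dual_tnth // bodies_dual 1?ltnW //.
by rewrite -conjgM invgK mulVg conjg1.
Qed.

(** * Arcs of the long cycle and the two indices *)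

(** Along the arc from [x], only the last value, [y], is affected by the transposition: it is
    redirected to [x]. *)
Lemma fcycle_mul_tperm pi x y q : x \notin q -> y \notin q ->
  path (frel pi) x q -> pi (last x q) = y -> fcycle (pi * tperm x y) (x :: q).
Proof.
move=> xq yq path_q last_q; rewrite /= rcons_path /= permM last_q tpermR eqxx andbT.
elim: q {1 4}x path_q xq yq {last_q} => [//|z q IH] w /= /andP[/eqP wz path_q].
rewrite !inE !negb_or => /andP[xz xq] /andP[yz yq].
by rewrite permM wz tpermD // eqxx IH.
Qed.

Lemma fcycle_porbit pi (c : seq V) x y :
  fcycle pi c -> x \in c -> y \in c -> y \in porbit pi x.
Proof.
move=> cyc xc yc; have xy : fconnect pi x y by rewrite (fconnect_cycle cyc).
by apply/porbitP; exists (findex pi x y); rewrite permX iter_findex.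
Qed.

(* Deleting the [k]-th transposition leaves a sequence with product
   [tperm x y * product s], whose orbits are the two arcs. *)
Lemma T_index_arcs s k x y (p1 p2 : seq V) : trees s ->
  x != y -> tnth s k = tperm x y ^ bodies s k ->
  fcycle (product s)^-1 (x :: p1 ++ y :: p2) -> uniq (x :: p1 ++ y :: p2) ->
  (forall z, z \in x :: p1 ++ y :: p2) ->
  T_index (graph_of s) (edge_of (tnth s k)) = minn (size p1).+1 (size p2).+1.
Proof.
move=> ts neq_xy s_k cyc uniq_c all_c.
pose s' := take k s ++ drop k.+1 s; pose rho := \prod_(t <- s') t.
have split_s : s = take k s ++ tnth s k :: drop k.+1 s :> seq _.
  rewrite -[LHS](cat_take_drop k) (drop_nth 1) ?size_tuple //.
  by rewrite (tnth_nth 1).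
have rhoV : rho^-1 = (product s)^-1 * tperm x y.
  (* Being a conjugate by the prefix product, the [k]-th factor moves to the front of the product as
     [tperm x y] and cancels there. *)
  have -> : rho = tperm x y * product s.
    rewrite /product split_s /rho /s' !big_cat big_cons /= s_k.
    by rewrite -/(bodies s k) /conjg !mulgA mulgK tperm2 mul1g.
  by rewrite invMg tpermV.
have tr' : all (@transposition m) s'.
  have := ts.1; rewrite {1}split_s !all_cat /=.
  by case/and3P=> -> _ ->.
pose e := edge_of (tnth s k).
have sub_e : edges s' \subset graph_of s :\ e.
  apply/subsetP=> _ /imsetP[t ts' ->]; rewrite in_setD1.
  have := trees_uniq ts; rewrite split_s map_cat /= cat_uniq /= negb_or.
  rewrite -!andbA => /and5P[_ k_l _ k_r _]; apply/andP; split; last first.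
    apply: imset_f; rewrite /= split_s mem_cat inE orbCA -mem_cat.
    by apply/orP; right.
  apply/eqP=> eq_t; move: ts'; rewrite mem_cat => /orP[] /(map_f (@edge_of m)).
    by rewrite eq_t (negPf k_l).
  by rewrite eq_t (negPf k_r).
pose R := connect (adj (graph_of s :\ e)).
have conn_arc c : fcycle rho^-1 c -> {in c &, forall a b, R a b}.
  move=> cyc_c a b ac bc; apply: connect_adjS sub_e _; apply: connect_porbit tr' _.
  by rewrite -porbitV (fcycle_porbit cyc_c).
have /and5P[x_c uniq_1 y_1 y_2 uniq_2] : [&& x \notin p1 ++ y :: p2, uniq p1,
    ~~ has (mem p1) (y :: p2), y \notin p2 & uniq p2].
  by move: uniq_c; rewrite /= cat_uniq.
move: x_c y_1; rewrite mem_cat inE /= !negb_or => /and3P[x_1 _ x_2] /andP[y_1 _].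
move: cyc; rewrite /= rcons_cat cat_path rcons_cons /= rcons_path.
case/and4P=> path_1 /eqP last_1 path_2 /eqP last_2.
have R1 : {in x :: p1 &, forall a b, R a b}.
  by apply: conn_arc; rewrite rhoV; apply: fcycle_mul_tperm.
have R2 : {in y :: p2 &, forall a b, R a b}.
  by apply: conn_arc; rewrite rhoV tpermC; apply: fcycle_mul_tperm.
have cover z : (z \in x :: p1) || (z \in y :: p2) by rewrite -mem_cat.
have sizeE (z : V) q : z \notin q -> uniq q -> (size q).+1 = #|[set w in z :: q]|.
  by move=> zq uq; rewrite cardsE; apply/esym/card_uniqP; rewrite /= zq.
rewrite (sizeE x) // (sizeE y) //.
set u := bodies s k in s_k; have neq_u : u x != u y by rewrite (inj_eq perm_inj).
have e_u : e = [set u x; u y] by rewrite /e s_k tpermJ edge_of_tperm.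
have sep : ~~ R (u x) (u y).
  have [_ _ ac] := trees_is_tree ts; rewrite /R e_u; apply: acyclic_bridge => //.
  by rewrite -e_u; apply/imset_f/mem_tnth.
have U12 : [set z in x :: p1] :|: [set z in y :: p2] = setT.
  by apply/setP=> z; rewrite in_setU in_setT !in_set cover.
have RA : {in [set z in x :: p1] &, forall a b, R a b}.
  by move=> a b; rewrite !in_set; apply: R1.
have RB : {in [set z in y :: p2] &, forall a b, R a b}.
  by move=> a b; rewrite !in_set; apply: R2.
(* Both ends of the deleted edge on one arc would contradict [sep]; otherwise the arcs are its two
   sides, in either order. *)
case/orP: (cover (u x)) => ux; case/orP: (cover (u y)) => uy.
- by rewrite R1 in sep.
- by apply: (@T_index_split _ _ _ _ _ (u x) (u y)); rewrite ?in_set.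
- apply: (@T_index_split _ _ _ _ _ (u y) (u x)); rewrite ?in_set //.
  by rewrite connect_adj_sym.
- by rewrite R2 in sep.
Qed.

Lemma C_index_arcs s k : all (@transposition m) s -> full_cycle (product s) ->
  exists x y p1 p2, [/\ x != y /\ tnth s k = tperm x y,
    fcycle (product s) (x :: p1 ++ y :: p2), uniq (x :: p1 ++ y :: p2),
    forall z, z \in x :: p1 ++ y :: p2
  & C_index s k = minn (size p1).+1 (size p2).+1].
Proof.
move=> tr fc; rewrite /C_index.
have [neq_xy eq_t] := ends_transposition (transposition_tnth k tr).
case: (ends _) neq_xy eq_t => x y neq_xy eq_t.
set c := fingraph.orbit _ x.
have all_c z : z \in c.
  by rewrite -fconnect_orbit; have /porbitP[i ->] := fc x z; rewrite permX fconnect_iter.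
have uniq_c : uniq c by apply: orbit_uniq.
have cyc_c : fcycle (product s) c by apply/cycle_orbit/perm_inj.
have [i p1 p2 arc1 arc2 rot_c] := rot_to_arc uniq_c (all_c x) (all_c y) neq_xy.
exists x, y, p1, p2; rewrite -arc1 -arc2 -rot_c rot_cycle rot_uniq.
by split=> // z; rewrite mem_rot.
Qed.

(** The inverse product of [t] is [product s ^ r], so [r] carries the arcs cut out by [tnth s k] to
    those of [T_index_arcs] for [t]. *)
Lemma C_index_T_index s r k : all (@transposition m) s -> full_cycle (product s) ->
  let t := conj_seq (dual s) r in
  C_index s k = T_index (graph_of t) (edge_of (tnth t k)).
Proof.
move=> tr fc t; have [x [y [p1 [p2 [[neq_xy s_k] cyc uniq_c all_c ->]]]]] := C_index_arcs k tr fc.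
have prodV : (product t)^-1 = product s ^ r.
  by rewrite product_conj product_dual // -conjVg invgK.
have trt : all (@transposition m) t by rewrite transposition_conj transposition_dual.
have fct : full_cycle (product t).
  by move=> a b; rewrite -porbitV prodV; apply: full_cycleJ.
rewrite -(size_map r p1) -(size_map r p2); apply/esym.
have mapE : [:: r x & map r p1 ++ r y :: map r p2] = map r (x :: p1 ++ y :: p2).
  by rewrite /= map_cat.
apply: (@T_index_arcs _ _ (r x) (r y)); rewrite ?mapE.
- exact: full_cycle_trees.
- by rewrite (inj_eq perm_inj).
- rewrite tnth_conj_seq dual_tnth // s_k bodies_conj bodies_dual 1?ltnW //.
  by rewrite -[tperm (r x) _]tpermJ -!conjgM -conjgC.
- rewrite prodV; apply: homo_cycle cyc => a b /= /eqP<-.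
  by rewrite /conjg !permM permK.
- by rewrite map_inj_uniq //; apply: perm_inj.
by move=> z; rewrite -(permKV r z) map_f.
Qed.

(** * The bijection *)

Lemma F_downP s :
  reflect (all (@transposition m) s /\ product s = (cycle_up m)^-1) (s \in F_down m).
Proof. by rewrite inE -cycle_upV; apply: (iffP andP) => -[-> /eqP]. Qed.

Lemma F_upP s :
  reflect (all (@transposition m) s /\ product s = cycle_up m) (s \in F_up m).
Proof. by rewrite inE; apply: (iffP andP) => -[-> /eqP]. Qed.

Lemma dual_F_up s : s \in F_down m -> dual s \in F_up m.
Proof.
case/F_downP=> tr prod_s; apply/F_upP; split; first exact: transposition_dual.
by rewrite product_dual // prod_s invgK.
Qed.

Lemma dual_F_down s : s \in F_up m -> dual s \in F_down m.
Proof.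
case/F_upP=> tr prod_s; apply/F_downP; split; first exact: transposition_dual.
by rewrite product_dual // prod_s.
Qed.

Lemma F_up_trees s : s \in F_up m -> trees s.
Proof.
by case/F_upP=> tr prod_s; apply: full_cycle_trees; rewrite ?prod_s //; apply: cycle_up_full.
Qed.

(* A permutation fixing the root is determined by how it conjugates the
   cycle. *)
Lemma cycle_up_conj_inj r1 r2 : r1 ord0 = ord0 -> r2 ord0 = ord0 ->
  cycle_up m ^ r1 = cycle_up m ^ r2 -> r1 = r2.
Proof.
move=> fix1 fix2 eq_c.
have act r v : r ord0 = ord0 -> ((cycle_up m ^ r) ^+ v) ord0 = r v.
  by move=> r0; rewrite -conjXg /conjg !permM -{1}r0 permK cycle_up_ord.
by apply/permP=> v; rewrite -[LHS]act // eq_c act.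
Qed.

(** The tree determines the conjugated sequence, its product determines the conjugator, and
    conjugating back recovers the original. *)
Lemma shift_labels_inj : {in F_up m &, injective (@shift_labels m)}.
Proof.
move=> s1 s2 F1 F2 eqT; have [ts1 ts2] := (F_up_trees F1, F_up_trees F2).
have [r1 [fix1 eq1 id1]] := shift_labels_conj ts1.
have [r2 [fix2 eq2 id2]] := shift_labels_conj ts2.
have eq_conj : conj_seq s1 r1 = conj_seq s2 r2.
  by apply: relabel_id_inj; rewrite -?eq1 -?eq2 //; apply: trees_conj.
have eq_r : r1 = r2.
  have [[_ prod1] [_ prod2]] := (F_upP _ F1, F_upP _ F2).
  by apply: cycle_up_conj_inj; rewrite // -{1}prod1 -prod2 -!product_conj eq_conj.
apply: eq_from_tnth => k; apply: (can_inj (conjgK r1)).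
by rewrite -tnth_conj_seq eq_conj tnth_conj_seq eq_r.
Qed.

Lemma shift_labels_surj (T : graph V) : is_tree T ->
  exists2 s, s \in F_up m & shift_labels s = T.
Proof.
case/tree_relabel_id=> t [tt graph_t id_t].
have [r [r0 eq_c]] := conj_full_cycle (trees_full_cycle tt).
have r0' : r^-1 ord0 = ord0 by rewrite -{1}r0 permK.
(* Since [t] is [s] conjugated by [r] and has trivial labels, [relabel s] is [r]. *)
pose s := conj_seq t r^-1; have ts : trees s by apply: trees_conj.
exists s; first by apply/F_upP; rewrite ts.1 product_conj -eq_c conjgK.
rewrite -graph_t; have -> : t = conj_seq s r.
  by apply: eq_from_tnth => k; rewrite !tnth_conj_seq conjgKV.
rewrite graph_of_conj ?ts.1 //; apply: eq_imset => e; apply: eq_imset => v.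
by rewrite -{1}(permK r v) relabel_conj // id_t.
Qed.

End TranspositionSequences.

Theorem theorem6p7 (m : nat) :
  [/\ {in F_down m, forall s : m.-tuple 'S_m.+1, dual s \in F_up m},
      {in F_down m, forall s : m.-tuple 'S_m.+1, is_tree (B s)},
      {in F_down m &, injective (@B m)},
      (forall T : graph 'I_m.+1, is_tree T ->
         exists2 s : m.-tuple 'S_m.+1, s \in F_down m & B s = T)
    & {in F_down m, forall s : m.-tuple 'S_m.+1,
        perm_eq [seq C_index s k | k <- enum 'I_m]
                [seq T_index (B s) e | e <- enum (B s)]}].
Proof.
split=> [s|s Fs|s1 s2 F1 F2 eqB|T treeT|s Fs]; first exact: dual_F_up.
- have ts := F_up_trees (dual_F_up Fs).
  have [r [_ eqB _]] := shift_labels_conj ts.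
  by rewrite /B eqB; apply/trees_is_tree/trees_conj.
- have := shift_labels_inj (dual_F_up F1) (dual_F_up F2) eqB.
  by move/(congr1 (@dual m)); rewrite !dualK //; [case/F_downP: F2 | case/F_downP: F1].
- have [t Ft eqT] := shift_labels_surj treeT; exists (dual t).
    exact: dual_F_down.
  by rewrite /B dualK //; case/F_upP: Ft.
have ts := F_up_trees (dual_F_up Fs); have [r [_ eqB _]] := shift_labels_conj ts.
have [tr prod_s] := F_downP _ Fs.
have fc : full_cycle (product s).
  by move=> x y; rewrite prod_s porbitV; apply: cycle_up_full.
rewrite /B eqB (eq_map (fun k => C_index_T_index r k tr fc)) map_comp.
(* Positions enumerate the edges of the tree without repetition, so equality position by position
   yields equality of multisets. *)
have inj := trees_edge_inj (trees_conj r ts).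
apply/perm_map/uniq_perm => [||e].
- by rewrite (map_inj_uniq inj); apply: enum_uniq.
- exact: enum_uniq.
rewrite mem_enum graph_of_tnth.
by apply/mapP/imsetP => -[k _ ->]; exists k; rewrite ?mem_enum.
Qed.
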